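(* Let $k$ be a field, $R=k[x_1,\ldots,x_n]$, and let $I$ be an almost reverse lexicographic ideal in $R$ whose last generator is $M_\omega=x_1^{\omega_1}\cdots x_\mu^{\omega_\mu}$ with $\omega_\mu>0$. Then the minimal monomial generating set of $I$ is \[\mathcal{G}(I)=\{x_1^{f_1}\}\cup\bigcup_{i=1}^{\mu-1}\{x^\alpha x_{i+1}^{f_{i+1}(\alpha)}:\ \alpha=(\alpha_1,\ldots,\alpha_i)\in\mathcal{I}_i\}.\]
   Context: Monomial order: degree reverse lexicographic: for $M=x^\alpha,N=x^\beta$, $M>N$ iff $\deg M>\deg N$, or degrees are equal and for the largest $s$ with $\alpha_s\neq\beta_s$ one has $\alpha_s<\beta_s$. For $\alpha\in\mathbb{Z}^s_{\ge0}$, $x^\alpha=x_1^{\alpha_1}\cdots x_s^{\alpha_s}$, $|\alpha|=\sum\alpha_j$, and $\alpha\le\beta$ iff $x^\alpha\le x^\beta$. A monomial ideal $I$ is almost reverse lexicographic if for every monomial $M$ and every minimal monomial generator $N$ of $I$ with $\deg M=\deg N$ and $M>N$, one has $M\in I$. $\mathcal{G}(I)$ is the minimal monomial generating set; $\max M$ is the largest $i$ with $x_i\mid M$. The last generator $M_\omega$ is the element of $\mathcal{G}(I)$ of maximal degree that is smallest in the order among elements of $\mathcal{G}(I)$ of that degree; $\mu=\max M_\omega$. $f_1=\min\{t:x_1^t\in I\}$; for $2\le i\le\mu$, $\alpha\in\mathbb{Z}^{i-1}_{\ge0}$, $f_i(\alpha)=\min\{t\ge0:x^\alpha x_i^t\in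 I\}\in\mathbb{Z}_{\ge0}\cup\{\infty\}$. For $1\le i\le\mu-2$, $\mathcal{I}_i=\{(\alpha_1,\ldots,\alpha_i)\in\mathbb{Z}^i_{\ge0}: 0\le\alpha_1<f_1,\ 0\le\alpha_j<f_j(\alpha_1,\ldots,\alpha_{j-1})\ (2\le j\le i)\}$, and $\mathcal{I}_{\mu-1}$ is the set of $(\alpha_1,\ldots,\alpha_{\mu-1})$ satisfying these inequalities for $j\le\mu-1$ together with $(\alpha_1,\ldots,\alpha_{\mu-1})\ge(\omega_1,\ldots,\omega_{\mu-1})$. (If $\mu=1$ the union is empty.) *)

(* Defs.v *)
From HB Require Import structures.
From mathcomp Require Import all_boot all_algebra.
From mathcomp Require Import mpoly.
Set Implicit Arguments. Unset Strict Implicit. Unset Printing Implicit Defensive.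
Import GRing.Theory.
Local Open Scope ring_scope.

(* Exponent vectors are handled as functions nat -> nat, 1-based:
   a j is the exponent of x_j (a 0 and a j for j > n are ignored / 0). *)

Definition ex (n : nat) (m : 'X_{1..n}) (j : nat) : nat :=
  if j is j'.+1 then nth 0%N (multinom_val m) j' else 0%N.

Definition mono (n : nat) (a : nat -> nat) : 'X_{1..n} :=
  [multinom a i.+1 | i < n].

Definition deg_s (s : nat) (a : nat -> nat) : nat := (\sum_(1 <= j < s.+1) a j)%N.

Definition drl_gt (s : nat) (a b : nat -> nat) : Prop :=
  (deg_s s b < deg_s s a)%N \/
  (deg_s s a = deg_s s b /\
   exists j, [/\ (1 <= j <= s)%N, (a j < b j)%N &
                 forall l, (j < l <= s)%N -> a l = b l]).

Definition drl_le (s : nat) (a b : nat -> nat) : Prop :=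
  (forall j, (1 <= j <= s)%N -> a j = b j) \/ drl_gt s b a.

Section MonIdeal.
Variables (k : fieldType) (n : nat).

Definition is_ideal (I : {pred {mpoly k[n]}}) : Prop :=
  [/\ 0 \in I,
      (forall p q, p \in I -> q \in I -> p + q \in I) &
      (forall r p, p \in I -> r * p \in I)].

Definition monomial_ideal (I : {pred {mpoly k[n]}}) : Prop :=
  is_ideal I /\
  forall p, p \in I ->
    exists s : seq ({mpoly k[n]} * 'X_{1..n}),
      (forall c, c \in s -> 'X_[c.2] \in I) /\
      p = \sum_(c <- s) c.1 * 'X_[c.2].

Definition mingen (I : {pred {mpoly k[n]}}) (m : 'X_{1..n}) : Prop :=
  'X_[m] \in I /\
  forall m' : 'X_{1..n}, (m' <= m)%MM -> 'X_[m'] \in I -> m' = m.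

Definition almost_revlex (I : {pred {mpoly k[n]}}) : Prop :=
  forall M N : 'X_{1..n}, mingen I N -> mdeg M = mdeg N ->
    drl_gt n (ex M) (ex N) -> 'X_[M] \in I.

Definition last_gen (I : {pred {mpoly k[n]}}) (w : 'X_{1..n}) : Prop :=
  [/\ mingen I w,
      (forall g, mingen I g -> (mdeg g <= mdeg w)%N) &
      (forall g, mingen I g -> mdeg g = mdeg w -> drl_le n (ex w) (ex g))].

Definition max_var (w : 'X_{1..n}) (mu : nat) : Prop :=
  [/\ (1 <= mu <= n)%N, (0 < ex w mu)%N & forall j, (mu < j)%N -> ex w j = 0%N].

Definition inI (I : {pred {mpoly k[n]}}) (a : nat -> nat) : Prop :=
  'X_[mono n a] \in I.

Definition pre (a : nat -> nat) (j : nat) : nat -> nat :=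
  fun l => if (1 <= l < j)%N then a l else 0%N.

Definition xpow (a : nat -> nat) (j t : nat) : nat -> nat :=
  fun l => if l == j then t else pre a j l.

(* t = f_j(a_1,...,a_{j-1}) (and this minimum is finite) ;
   for j = 1 this is t = f_1 *)
Definition is_f (I : {pred {mpoly k[n]}}) (a : nat -> nat) (j t : nat) : Prop :=
  inI I (xpow a j t) /\ forall t', (t' < t)%N -> ~ inI I (xpow a j t').

(* b < f_j(a_1,...,a_{j-1}), where f_j = min{t : ...} in N u {oo} *)
Definition lt_f (I : {pred {mpoly k[n]}}) (a : nat -> nat) (j b : nat) : Prop :=
  forall t, inI I (xpow a j t) -> (b < t)%N.

Definition in_calI (I : {pred {mpoly k[n]}}) (w : 'X_{1..n}) (mu i : nat)
    (alpha : nat -> nat) : Prop :=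
  [/\ (forall l, (l == 0%N) || (i < l)%N -> alpha l = 0%N),
      (forall j, (1 <= j <= i)%N -> lt_f I alpha j (alpha j)) &
      (i = mu.-1 -> drl_le mu.-1 (ex w) alpha)].

End MonIdeal.

(* Main.v *)
Require Import Defs.
From HB Require Import structures.
From mathcomp Require Import all_boot all_algebra.
From mathcomp Require Import mpoly.
From mathcomp Require Import zify.
From Stdlib Require Import Classical.
Set Implicit Arguments. Unset Strict Implicit. Unset Printing Implicit Defensive.

(* The minimal generators are sorted by their largest variable p: writing m = x^a x_p^t,
   minimality of m forces t = f_p(a) and a_j < f_j(a_1, ..., a_(j-1)) for j < p.
   Conversely, a minimal generator N dividing x^a x_(i+1)^f with f = f_(i+1)(a) must have
   x_(i+1)-exponent f, and if N_l < a_l for some l <= i then almost revlex puts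
   x_l N / x_(i+1) in I, a divisor of x^a x_(i+1)^(f-1). The bounds p <= mu and, for
   p = mu, (a_1, ..., a_(mu-1)) >= (w_1, ..., w_(mu-1)) come from the last generator:
   otherwise some divisor u of M_w with deg u = deg m is larger than m, so u lies in I,
   hence u = M_w, contradicting that M_w is the smallest generator of maximal degree. *)

Section Exponents.
Local Open Scope nat_scope.
Variable n : nat.

Lemma ex_ord (m : 'X_{1..n}) (i : 'I_n) : ex m i.+1 = m i.
Proof. by rewrite /= mnm_tnth (tnth_nth 0). Qed.

Lemma ex_out (m : 'X_{1..n}) j : (j == 0) || (n < j) -> ex m j = 0.
Proof. by case: j => [|j] //= Hj; apply: nth_default; rewrite size_tuple. Qed.

Lemma ex_mono a j : ex (mono n a) j = if (1 <= j <= n) then a j else 0.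
Proof.
case: j => [|j] //; case: ifP => Hj.
  by have := ex_ord (mono n a) (Ordinal Hj); rewrite mnmE.
by apply: ex_out; move: Hj => /negbT; rewrite /= -ltnNge.
Qed.

Lemma mnm_ex (m1 m2 : 'X_{1..n}) :
  (forall j, (1 <= j <= n) -> ex m1 j = ex m2 j) -> m1 = m2.
Proof. by move=> H; apply/mnmP => i; have := H i.+1 (ltn_ord i); rewrite !ex_ord. Qed.

Lemma mono_ex (m : 'X_{1..n}) : mono n (ex m) = m.
Proof. by apply: mnm_ex => j Hj; rewrite ex_mono Hj. Qed.

Lemma eq_mono a b : (forall j, (1 <= j <= n) -> a j = b j) -> mono n a = mono n b.
Proof. by move=> H; apply: mnm_ex => j Hj; rewrite !ex_mono Hj H. Qed.

Lemma lepm_ex (m1 m2 : 'X_{1..n}) :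
  (m1 <= m2)%MM <-> (forall j, (1 <= j <= n) -> (ex m1 j <= ex m2 j)).
Proof.
split => [/mnm_lepP H [|j] // Hj | H].
  by have := H (Ordinal Hj); rewrite -!ex_ord.
by apply/mnm_lepP => i; have := H i.+1 (ltn_ord i); rewrite !ex_ord.
Qed.

Lemma mdeg_ex (m : 'X_{1..n}) : mdeg m = deg_s n (ex m).
Proof.
by rewrite mdegE /deg_s big_add1 /= big_mkord; apply: eq_bigr => i _; rewrite -ex_ord.
Qed.

End Exponents.

Section Degree.
Local Open Scope nat_scope.

Lemma eq_deg_s s a b : (forall j, 1 <= j <= s -> a j = b j) -> deg_s s a = deg_s s b.
Proof. by move=> H; apply: eq_big_nat => j /andP[H1 H2]; apply: H; rewrite H1 -ltnS. Qed.

Lemma deg_s_recr s a : deg_s s.+1 a = deg_s s a + a s.+1.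
Proof. by rewrite /deg_s big_nat_recr. Qed.

Lemma deg_sD s a b : deg_s s (fun l => a l + b l) = deg_s s a + deg_s s b.
Proof. by rewrite /deg_s big_split. Qed.

Lemma deg_s_delta s j : 1 <= j <= s -> deg_s s (fun l => nat_of_bool (l == j)) = 1.
Proof.
move=> Hj; rewrite /deg_s (bigD1_seq j) ?iota_uniq ?mem_iota //=; last by lia.
by rewrite eqxx big1 // => l /negbTE ->.
Qed.

Lemma deg_s_pad s s' a : s <= s' -> (forall l, s < l -> a l = 0) ->
  deg_s s' a = deg_s s a.
Proof.
move=> /subnKC <- H; elim: (s' - s) => [|d IH]; first by rewrite addn0.
by rewrite addnS deg_s_recr IH H ?addn0 //; lia.
Qed.

Lemma ltn_deg_s s a b j : (forall j, 1 <= j <= s -> a j <= b j) ->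
  1 <= j <= s -> a j < b j -> deg_s s a < deg_s s b.
Proof.
move=> H Hj Hlt; rewrite /deg_s !(bigD1_seq j) ?iota_uniq ?mem_iota //=; try lia.
rewrite -addSn leq_add // big_nat_cond [X in _ <= X]big_nat_cond.
by apply: leq_sum => l /andP[/andP[l1 l2] _]; apply: H; lia.
Qed.

Lemma exists_divisor_deg s v e : e <= deg_s s v ->
  exists u, [/\ forall l, u l <= v l, forall l, s < l -> u l = 0 & deg_s s u = e].
Proof.
elim: s e => [|s IH] e He.
  by exists (fun _ => 0); split=> //; move: He; rewrite /deg_s !big_geq //; lia.
case: (leqP e (deg_s s v)) => Hle.
  have [u [H1 H2 H3]] := IH e Hle.
  exists u; split=> [//|l Hl|]; first by apply: H2; lia.
  by rewrite deg_s_recr H3 H2 ?addn0.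
exists (fun l => if l <= s then v l else if l == s.+1 then e - deg_s s v else 0).
split=> [l|l Hl|].
- case: ifP => // _; case: eqP => // ->; rewrite deg_s_recr in He; lia.
- by rewrite ifF ?ifF //; apply/negbTE; lia.
- rewrite deg_s_recr ifF ?eqxx; last lia.
  rewrite (@eq_deg_s s _ v); first lia.
  by move=> j Hj; rewrite ifT //; lia.
Qed.

Lemma last_pos_index s a : (exists j, 1 <= j <= s /\ 0 < a j) ->
  exists p, [/\ 1 <= p <= s, 0 < a p & forall l, p < l <= s -> a l = 0].
Proof.
elim: s => [|s IH] [j [Hj a_j]]; first lia.
case: (posnP (a s.+1)) => H; last by exists s.+1; split=> //; lia.
have [|p [Hp ap Htail]] := IH.
  by exists j; split=> //; case: (ltngtP j s.+1) => Hjs; [lia|lia|move: a_j; rewrite Hjs H].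
exists p; split=> [|//|l Hl]; first lia.
by case: (ltngtP l s.+1) => Hls; [apply: Htail; lia|lia|rewrite Hls].
Qed.

End Degree.

Section DegRevLex.
Local Open Scope nat_scope.

Lemma eq_drl_gt s a b a' b' : (forall j, 1 <= j <= s -> a j = a' j) ->
  (forall j, 1 <= j <= s -> b j = b' j) -> drl_gt s a b -> drl_gt s a' b'.
Proof.
move=> Ha Hb; rewrite /drl_gt (eq_deg_s Ha) (eq_deg_s Hb).
case=> [H|[H [j [Hj Hlt Htail]]]]; [by left|right; split=> //].
exists j; split=> //; first by rewrite -Ha // -Hb.
by move=> l Hl; rewrite -Ha ?Htail ?Hb //; lia.
Qed.

Lemma drl_le_ngt s a b : drl_le s a b -> ~ drl_gt s a b.
Proof.
case=> [Heq|[H|[H [j [Hj Hlt Htail]]]]] [H'|[H' [j' [Hj' Hlt' Htail']]]]; try lia.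
- by move: H'; rewrite (eq_deg_s Heq); lia.
- by have := Heq j' Hj'; lia.
- by case: (ltngtP j j') => Hjj; [have := Htail j'|have := Htail' j|subst j']; lia.
Qed.

Lemma tail_trichotomy s a b :
  (forall j, 1 <= j <= s -> a j = b j) \/
  (exists j, [/\ 1 <= j <= s, a j < b j & forall l, j < l <= s -> a l = b l]) \/
  (exists j, [/\ 1 <= j <= s, b j < a j & forall l, j < l <= s -> a l = b l]).
Proof.
elim: s => [|s IH]; first by left => j; lia.
have ext j l : j <= s -> (forall l, j < l <= s -> a l = b l) ->
    a s.+1 = b s.+1 -> j < l <= s.+1 -> a l = b l.
  by move=> Hj Htail Hs Hl; case: (ltngtP l s.+1) => Hls; [apply: Htail; lia|lia|rewrite Hls].
case: (ltngtP (a s.+1) (b s.+1)) => Hs.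
- by right; left; exists s.+1; split=> //; lia.
- by right; right; exists s.+1; split=> //; lia.
case: IH => [Heq|[[j [Hj Hlt Htail]]|[j [Hj Hlt Htail]]]].
- by left => j Hj; apply: (ext 0) => // l Hl; apply: Heq; lia.
- by right; left; exists j; split=> [||l]; [lia|done|apply: ext => //; lia].
- by right; right; exists j; split=> [||l]; [lia|done|apply: ext => //; lia].
Qed.

Lemma drl_total s a b : drl_le s a b \/ drl_gt s a b.
Proof.
case: (ltngtP (deg_s s a) (deg_s s b)) => Hdeg.
- by left; right; left.
- by right; left.
case: (tail_trichotomy s a b) => [Heq|[[j Hj]|[j [Hj Hlt Htail]]]].
- by left; left.
- by right; right; split=> //; exists j.
- left; right; right; split=> //; exists j; split=> // l Hl.
  by rewrite Htail.
Qed.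

End DegRevLex.

Section Prefix.
Local Open Scope nat_scope.

Lemma xpow_succ_supp (a : nat -> nat) i t l : (forall l, (l == 0) || (i < l) -> a l = 0) ->
  xpow a i.+1 t l = if l == i.+1 then t else a l.
Proof.
move=> Ha; rewrite /xpow /pre; case: eqP => // Hl; case: ifP => // H.
by rewrite Ha //; lia.
Qed.

Lemma xpow_self_supp (a : nat -> nat) i l : (forall l, (l == 0) || (i < l) -> a l = 0) ->
  xpow a i (a i) l = a l.
Proof.
move=> Ha; rewrite /xpow /pre; case: eqP => [->//|Hl]; case: ifP => // H.
by rewrite Ha //; lia.
Qed.

Lemma xpow_pre_last (a : nat -> nat) p l : 1 <= l -> (forall l, p < l -> a l = 0) ->
  xpow (pre a p) p (a p) l = a l.
Proof.
move=> Hl Ha; rewrite /xpow /pre; case: eqP => [->//|Hlp].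
case: ifP => [->//|/negbT Hl']; rewrite Ha //; lia.
Qed.

Lemma eq_xpow (a b : nat -> nat) j t l : (forall l, 1 <= l < j -> a l = b l) ->
  xpow a j t l = xpow b j t l.
Proof. by move=> Hab; rewrite /xpow /pre; case: ifP => // _; case: ifP => // /Hab. Qed.

End Prefix.

Section MonomialIdeal.
Local Open Scope nat_scope.
Variables (k : fieldType) (n : nat) (I : {pred {mpoly k[n]}}).

Lemma inI_eq a b : (forall j, 1 <= j <= n -> a j = b j) -> inI I a -> inI I b.
Proof. by move=> Hab; rewrite /inI (eq_mono Hab). Qed.

Lemma mingen_le m b : mingen I m -> (forall j, 1 <= j <= n -> b j <= ex m j) ->
  inI I b -> forall j, 1 <= j <= n -> b j = ex m j.
Proof.
case=> _ Hmin Hb Hin j Hj.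
have Hle : (mono n b <= m)%MM by apply/lepm_ex => l Hl; rewrite ex_mono Hl Hb.
by rewrite -(Hmin _ Hle Hin) ex_mono Hj.
Qed.

Lemma mingen_intro c : inI I c ->
  (forall b, (forall j, 1 <= j <= n -> b j <= c j) -> inI I b ->
     forall j, 1 <= j <= n -> b j = c j) -> mingen I (mono n c).
Proof.
move=> Hc H; split=> // m' /lepm_ex Hle Hin; apply: mnm_ex => j Hj.
rewrite ex_mono Hj; apply: H => //; last by rewrite /inI mono_ex.
by move=> l Hl; have := Hle l Hl; rewrite ex_mono Hl.
Qed.

Lemma not_mingen_proper_divisor a : inI I a -> ~ mingen I (mono n a) ->
  exists b, [/\ forall j, 1 <= j <= n -> b j <= a j, deg_s n b < deg_s n a & inI I b].
Proof.
move=> Ha Hnm.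
have [m' Hm'] : exists m', ~ ((m' <= mono n a)%MM -> 'X_[m'] \in I -> m' = mono n a).
  by apply: not_all_ex_not => H; apply: Hnm.
have [/lepm_ex Hdvd Hm''] := imply_to_and _ _ Hm'.
have [Hin Hne] := imply_to_and _ _ Hm''.
have Hle j : 1 <= j <= n -> ex m' j <= a j by move=> Hj; have := Hdvd j Hj; rewrite ex_mono Hj.
have [/hasP[j Hj lt_j]|/hasPn Hge] := boolP (has (fun j => ex m' j < a j) (iota 1 n)).
  exists (ex m'); split=> //; last by rewrite /inI mono_ex.
  by apply: (ltn_deg_s Hle _ lt_j); move: Hj; rewrite mem_iota; lia.
case: Hne; apply: mnm_ex => j Hj; rewrite ex_mono Hj.
by apply/eqP; rewrite eqn_leq Hle //= leqNgt Hge // mem_iota; lia.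
Qed.

Lemma exists_mingen_dvd a : inI I a ->
  exists N, mingen I N /\ forall j, 1 <= j <= n -> ex N j <= a j.
Proof.
have [d] := ubnP (deg_s n a); elim: d a => // d IH a /ltnSE le_ad Ha.
case: (classic (mingen I (mono n a))) => [Hm|Hnm].
  by exists (mono n a); split=> // j Hj; rewrite ex_mono Hj.
have [b [Hba lt_ba Hb]] := not_mingen_proper_divisor Ha Hnm.
have [|N [HN HNb]] := IH b _ Hb; first lia.
by exists N; split=> // j Hj; apply: leq_trans (HNb j Hj) (Hba j Hj).
Qed.

Lemma is_f_eq a b j t : (forall l, 1 <= l < j -> a l = b l) -> is_f I a j t -> is_f I b j t.
Proof.
move=> Hab [Ht Hmin]; split=> [|t' lt_t' Hin]; first by apply: inI_eq Ht => l _; apply: eq_xpow.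
by apply: (Hmin t' lt_t'); apply: inI_eq Hin => l _; apply: eq_xpow => q /Hab.
Qed.

Hypothesis I_ideal : is_ideal I.

Lemma inI_dvd a b : inI I a -> (forall j, 1 <= j <= n -> a j <= b j) -> inI I b.
Proof.
case: I_ideal => _ _ I_mul Ha H.
have Hle : (mono n a <= mono n b)%MM by apply/lepm_ex => j Hj; rewrite !ex_mono Hj H.
by rewrite /inI -(submK Hle) mpolyXD; apply: I_mul.
Qed.

Hypothesis I_arl : almost_revlex I.

Lemma almost_revlex_inI N b : mingen I N ->
  deg_s n b = deg_s n (ex N) -> drl_gt n b (ex N) -> inI I b.
Proof.
move=> HN Hd Hg; apply: (@I_arl (mono n b) N HN).
  by rewrite !mdeg_ex -Hd; apply: eq_deg_s => j Hj; rewrite ex_mono Hj.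
by apply: eq_drl_gt Hg => // j Hj; rewrite ex_mono Hj.
Qed.

Lemma almost_revlex_exchange N l j : mingen I N -> 1 <= l < j -> j <= n -> 0 < ex N j ->
  inI I (fun q => if q == l then (ex N l).+1 else if q == j then (ex N j).-1 else ex N q).
Proof.
move=> HN Hlj Hjn HNj; set N' := fun q => _.
have deg_N' : deg_s n N' = deg_s n (ex N).
  have := deg_sD n N' (fun q => q == j); rewrite deg_s_delta; last lia.
  rewrite (@eq_deg_s n _ (fun q => ex N q + (q == l))) ?deg_sD ?deg_s_delta; try lia.
  move=> q Hq; rewrite /N'.
  have /negbTE Elj : l != j by lia.
  case: (eqVneq q l) => [->|Hql]; first by rewrite Elj addn0 addn1.
  by case: (eqVneq q j) => [->|Hqj]; lia.
apply: (almost_revlex_inI HN deg_N'); right; split=> //; exists j; split.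
- lia.
- by rewrite /N' ifF ?eqxx; [lia|apply/eqP; lia].
- by move=> q Hq; rewrite /N' !ifF //; apply/eqP; lia.
Qed.

Lemma mingen_x1_pow t : 1 <= n -> is_f I (fun _ => 0) 1 t ->
  mingen I (mono n (xpow (fun _ => 0) 1 t)).
Proof.
move=> n_pos [Ht Hmin]; apply: mingen_intro => // b Hb Hin.
have Eb j : 1 <= j <= n -> b j = xpow (fun _ => 0) 1 (b 1) j.
  move=> Hj; have := Hb j Hj; rewrite /xpow /pre.
  by case: eqP => [->//|_]; rewrite if_same; lia.
have b1_le : b 1 <= t by have := Hb 1; rewrite /xpow eqxx; apply; lia.
have b1_ge : ~ b 1 < t by move=> b1_lt; apply: (Hmin _ b1_lt); apply: inI_eq Hin.
have -> : t = b 1 by lia.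
exact: Eb.
Qed.

Lemma mingen_dvd_xpow_eq i (a : nat -> nat) t N : 1 <= i < n ->
  (forall l, (l == 0) || (i < l) -> a l = 0) -> is_f I a i.+1 t -> 0 < t -> mingen I N ->
  (forall l, 1 <= l <= n -> ex N l <= xpow a i.+1 t l) ->
  forall l, 1 <= l <= n -> ex N l = xpow a i.+1 t l.
Proof.
move=> Hi Ha [_ Hmin] t_pos HN HNc.
have Ec l : xpow a i.+1 t l = if l == i.+1 then t else a l by exact: xpow_succ_supp.
have HNin : inI I (ex N) by rewrite /inI mono_ex; case: HN.
have N_t : ex N i.+1 = t.
  have := HNc i.+1; rewrite Ec eqxx => /(_ ltac:(lia)) HNt.
  case: (ltngtP (ex N i.+1) t) => // [lt_Nt|]; last lia.
  case: (Hmin _ lt_Nt); apply: (inI_dvd HNin) => l Hl; have := HNc l Hl.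
  by rewrite Ec xpow_succ_supp //; case: eqP => [->|].
have N_a l : 1 <= l <= i -> ex N l = a l.
  move=> Hl; have := HNc l; rewrite Ec ifF => [/(_ ltac:(lia)) HNl|]; last by apply/eqP; lia.
  case: (ltngtP (ex N l) (a l)) => // [lt_Na|]; last lia.
  have l_lt : 1 <= l < i.+1 by lia.
  have i_n : i.+1 <= n by lia.
  have N_pos : 0 < ex N i.+1 by rewrite N_t.
  case: (Hmin t.-1); first lia.
  apply: (inI_dvd (almost_revlex_exchange HN l_lt i_n N_pos)) => q Hq.
  rewrite xpow_succ_supp //.
  have [->|_] := eqVneq q l; first by rewrite ifF //; apply/eqP; lia.
  have [_|Hqi] := eqVneq q i.+1; first lia.
  by have := HNc q Hq; rewrite Ec (negbTE Hqi).
move=> l Hl; rewrite Ec; case: eqP => [->//|Hli].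
have [Hli'|lt_il] := leqP l i; first by apply: N_a; lia.
by have := HNc l Hl; rewrite Ec ifF ?Ha; [lia|lia|apply/eqP].
Qed.

Lemma mingen_xpow_is_f i (a : nat -> nat) t : 1 <= i < n ->
  (forall l, (l == 0) || (i < l) -> a l = 0) ->
  lt_f I a i (a i) -> is_f I a i.+1 t -> mingen I (mono n (xpow a i.+1 t)).
Proof.
move=> Hi Ha Hlt f_t; have [Hin _] := f_t.
have t_pos : 0 < t.
  case: (posnP t) => // t0; have := Hlt (a i); rewrite ltnn; apply.
  apply: inI_eq Hin => l Hl; rewrite xpow_succ_supp // xpow_self_supp // t0.
  by case: eqP => // ->; rewrite Ha // ltnSn orbT.
apply: mingen_intro => // b Hbc Hb.
have [N [HN HNb]] := exists_mingen_dvd Hb.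
have HNc l : 1 <= l <= n -> ex N l <= xpow a i.+1 t l.
  by move=> Hl; apply: leq_trans (HNb l Hl) (Hbc l Hl).
move=> l Hl; have := mingen_dvd_xpow_eq Hi Ha f_t t_pos HN HNc Hl.
by have := HNb l Hl; have := Hbc l Hl; lia.
Qed.

Variable w : 'X_{1..n}.
Hypothesis w_last : last_gen I w.

Lemma last_gen_drl_max m u : mingen I m -> (forall j, 1 <= j <= n -> u j <= ex w j) ->
  deg_s n u = deg_s n (ex m) -> ~ drl_gt n u (ex m).
Proof.
case: w_last => w_gen _ w_least Hm Huw Hdeg Hgt.
have Eu := mingen_le w_gen Huw (almost_revlex_inI Hm Hdeg Hgt).
have Emw : mdeg m = mdeg w by rewrite !mdeg_ex -Hdeg; apply: eq_deg_s.
by apply: (drl_le_ngt (w_least m Hm Emw)); apply: eq_drl_gt Hgt.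
Qed.

Lemma last_gen_prefix_deg_lt m p : mingen I m -> 1 <= p <= n -> 0 < ex m p ->
  (forall l, p < l -> ex m l = 0) -> deg_s p.-1 (ex w) < deg_s n (ex m).
Proof.
move=> Hm Hp m_p m_tail; rewrite ltnNge; apply/negP => Hle.
have [u [Huw u_tail deg_u]] := exists_divisor_deg Hle.
have deg_u_n : deg_s n u = deg_s n (ex m) by rewrite (@deg_s_pad p.-1) //; lia.
apply: (last_gen_drl_max Hm (u := u)) => //.
right; split=> //; exists p; split=> [||l Hl]; first lia.
  by rewrite u_tail //; lia.
by rewrite u_tail ?m_tail //; lia.
Qed.

Variable mu : nat.
Hypothesis w_max : max_var w mu.

Lemma mingen_exists_pos m : mingen I m -> exists j, 1 <= j <= n /\ 0 < ex m j.
Proof.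
case: w_last w_max => w_gen _ _ [Hmu w_mu _] Hm.
have [/hasP[j Hj m_j]|/hasPn m0] := boolP (has (fun j => 0 < ex m j) (iota 1 n)).
  by exists j; split=> //; move: Hj; rewrite mem_iota; lia.
have m0' j : 1 <= j <= n -> ex m j = 0.
  by move=> Hj; apply/eqP; rewrite eqn0Ngt; apply: m0; rewrite mem_iota; lia.
have Hinm : inI I (ex m) by rewrite /inI mono_ex; case: Hm.
have Hmw j : 1 <= j <= n -> ex m j <= ex w j by move=> Hj; rewrite m0'.
by have := mingen_le w_gen Hmw Hinm Hmu; rewrite m0' //; lia.
Qed.

Lemma mingen_maxvar_le m p : mingen I m -> 1 <= p <= n -> 0 < ex m p ->
  (forall l, p < l -> ex m l = 0) -> p <= mu.
Proof.
move=> Hm Hp m_p m_tail; rewrite leqNgt; apply/negP => lt_mu_p.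
have := last_gen_prefix_deg_lt Hm Hp m_p m_tail.
case: w_last w_max => _ w_deg _ [_ _ w_tail].
rewrite -(@deg_s_pad p.-1 n) => [||l Hl]; [|lia|apply: w_tail; lia].
by rewrite -!mdeg_ex ltnNge w_deg.
Qed.

Lemma mingen_is_f m p : mingen I m -> 1 <= p <= n -> (forall l, p < l -> ex m l = 0) ->
  is_f I (pre (ex m) p) p (ex m p).
Proof.
move=> Hm Hp m_tail; have Hinm : inI I (ex m) by rewrite /inI mono_ex; case: Hm.
split; first by apply: inI_eq Hinm => l Hl; rewrite xpow_pre_last //; lia.
move=> t lt_t Hin.
suff /(mingen_le Hm)/(_ Hin p Hp) : forall l, 1 <= l <= n -> xpow (pre (ex m) p) p t l <= ex m l.
  by rewrite /xpow eqxx; lia.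
by move=> l Hl; rewrite /xpow /pre; case: eqP => [->|_]; [lia|case: ifP => //; case: ifP].
Qed.

Lemma mingen_lt_f m p j : mingen I m -> 1 <= j < p -> p <= n -> 0 < ex m p ->
  lt_f I (pre (ex m) p) j (ex m j).
Proof.
move=> Hm Hjp Hpn m_p t Hin; rewrite ltnNge; apply/negP => le_t.
suff /(mingen_le Hm)/(_ Hin p) : forall l, 1 <= l <= n -> xpow (pre (ex m) p) j t l <= ex m l.
  by rewrite /xpow /pre ifF ?ifF; try lia; apply/eqP; lia.
move=> l Hl; rewrite /xpow /pre; case: eqP => [->//|_].
by case: ifP => // _; case: ifP.
Qed.

Lemma mingen_prefix_drl m i : mingen I m -> i.+1 = mu -> 0 < ex m mu ->
  (forall l, mu < l -> ex m l = 0) -> drl_le i (ex w) (pre (ex m) mu).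
Proof.
case: w_last w_max => _ w_deg _ [Hmu _ w_tail] Hm Emu; rewrite -Emu in Hmu w_tail * => m_mu m_tail.
case: (drl_total i (ex w) (pre (ex m) i.+1)) => // w_gt; exfalso.
set e := deg_s n (ex m); set Om := deg_s i (ex w); set A := deg_s i (pre (ex m) i.+1).
have lt_Om_e : Om < e by exact: last_gen_prefix_deg_lt Hm Hmu m_mu m_tail.
have e_eq : e = A + ex m i.+1.
  rewrite /e (@deg_s_pad i.+1) ?deg_s_recr /A; [congr (_ + _)|lia|done].
  by apply: eq_deg_s => l Hl; rewrite /pre ifT //; lia.
have le_e_d : e <= Om + ex w i.+1.
  by have := w_deg m Hm; rewrite !mdeg_ex (@deg_s_pad i.+1 n (ex w)) ?deg_s_recr //; lia.
pose u l := if l == i.+1 then e - Om else ex w l.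
have deg_u : deg_s n u = e.
  rewrite (@deg_s_pad i.+1) => [||l Hl]; [|lia|by rewrite /u ifF ?w_tail //; apply/eqP; lia].
  rewrite deg_s_recr /u eqxx (@eq_deg_s i _ (ex w)) -/Om; first lia.
  by move=> l Hl; rewrite ifF //; apply/eqP; lia.
apply: (last_gen_drl_max Hm (u := u)) => //.
  by move=> l Hl; rewrite /u; case: eqP => [->|]; lia.
right; split=> //.
have u_tail l : i.+1 < l -> u l = ex m l.
  by move=> Hl; rewrite /u ifF ?w_tail ?m_tail //; apply/eqP; lia.
case: w_gt => [lt_A_Om|[eq_A [j [Hj lt_j tail_j]]]].
  exists i.+1; split=> [||l Hl]; [lia|rewrite /u eqxx; lia|apply: u_tail; lia].
have u_pre l : 1 <= l <= i -> u l = ex w l by move=> Hl; rewrite /u ifF //; apply/eqP; lia.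
have pre_m l : 1 <= l <= i -> pre (ex m) i.+1 l = ex m l by move=> Hl; rewrite /pre ifT //; lia.
exists j; split=> [||l Hl]; first lia.
  by rewrite u_pre -?pre_m //; lia.
case: (ltngtP l i.+1) => Hli; last by rewrite Hli /u eqxx; lia.
  by rewrite u_pre ?tail_j ?pre_m //; lia.
by apply: u_tail.
Qed.

Lemma mingen_classify m : mingen I m ->
    (exists t, is_f I (fun _ => 0) 1 t /\ m = mono n (xpow (fun _ => 0) 1 t)) \/
    (exists i, 1 <= i <= mu.-1 /\
       exists alpha, in_calI I w mu i alpha /\
         exists t, is_f I alpha i.+1 t /\ m = mono n (xpow alpha i.+1 t)).
Proof.
move=> Hm; have [p [Hp m_p m_tail']] := last_pos_index (mingen_exists_pos Hm).
have m_tail l : p < l -> ex m l = 0.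
  by move=> Hl; case: (leqP l n) => Hln; [apply: m_tail'; lia|apply: ex_out; lia].
have Em : m = mono n (xpow (pre (ex m) p) p (ex m p)).
  by rewrite -{1}(mono_ex m); apply: eq_mono => l Hl; rewrite xpow_pre_last //; lia.
have f_p := mingen_is_f Hm Hp m_tail.
have [Ep|p_ne1] := eqVneq p 1.
  rewrite Ep in Em f_p; left; exists (ex m 1); split; first by apply: is_f_eq f_p; lia.
  by rewrite {1}Em; apply: eq_mono => l _; apply: eq_xpow; lia.
have [i Ep i_pos] : exists2 i, p = i.+1 & 1 <= i by exists p.-1; lia.
rewrite Ep in Hp m_p m_tail Em f_p.
have le_p_mu := mingen_maxvar_le Hm Hp m_p m_tail.
right; exists i; split; first lia.
exists (pre (ex m) i.+1); split; last by exists (ex m i.+1).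
split=> [l Hl|j Hj|Ei].
- by rewrite /pre ifF //; lia.
- rewrite [X in lt_f _ _ _ X]/pre ifT; last lia.
  by apply: (mingen_lt_f Hm) => //; lia.
- have Emu : i.+1 = mu by lia.
  by rewrite -Ei Emu; apply: (mingen_prefix_drl Hm Emu); rewrite -Emu.
Qed.

End MonomialIdeal.

Local Open Scope ring_scope.

Theorem proposition2p10 (k : fieldType) (n : nat) (I : {pred {mpoly k[n]}})
    (w : 'X_{1..n}) (mu : nat) :
  monomial_ideal I -> almost_revlex I -> last_gen I w -> max_var w mu ->
  forall m : 'X_{1..n},
    mingen I m <->
    (exists t, is_f I (fun _ => 0%N) 1 t /\ m = mono n (xpow (fun _ => 0%N) 1 t)) \/
    (exists i, (1 <= i <= mu.-1)%N /\
       exists alpha, in_calI I w mu i alpha /\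
         exists t, is_f I alpha i.+1 t /\ m = mono n (xpow alpha i.+1 t)).
Proof.
move=> [I_ideal _] I_arl w_last w_max m; have [mu_n _ _] := w_max.
split; first exact: mingen_classify.
case=> [[t [f_t ->]]|[i [Hi [a [[a_supp a_lt _] [t [f_t ->]]]]]]].
- by apply: mingen_x1_pow f_t; lia.
- by apply: mingen_xpow_is_f => //; [lia|apply: a_lt; lia].
Qed.
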